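(* Let $r>0$ and let $X_1$ and $X_2$ be independent $\Gamma(r,1)$ random variables. For $\alpha\in\mathbb{R}$ let $Z_\alpha = \alpha X_1 + (2-\alpha)X_2$. Then the function $\alpha\mapsto \operatorname{Med}(Z_\alpha)$ is strictly increasing on $(0,1)$, strictly decreasing on $(1,2)$, and satisfies $\operatorname{Med}(Z_\alpha)=\operatorname{Med}(Z_{2-\alpha})$ for $0<\alpha<2$.
   Context: For $r>0$ and $\lambda>0$, $\Gamma(r,\lambda)$ denotes the gamma distribution with shape $r$ and rate $\lambda$, i.e. with density $\frac{\lambda^r}{\Gamma(r)}x^{r-1}e^{-\lambda x}$, $x>0$. The median of a real-valued random variable $X$ is $\operatorname{Med}(X)=\inf\{x\in\mathbb{R}: P(X\le x)\ge 1/2\}$. *)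

(* Defs.v *)
From HB Require Import structures.
From mathcomp Require Import all_boot all_order all_algebra.
From mathcomp Require Import all_classical all_reals all_analysis.

Set Implicit Arguments.
Unset Strict Implicit.
Unset Printing Implicit Defensive.

Import Order.TTheory GRing.Theory Num.Theory.
Import numFieldNormedType.Exports.

Local Open Scope classical_set_scope.
Local Open Scope ring_scope.

(* Euler's Gamma function. [Rintegral] is [fine] of the extended-real Lebesgue
   integral, which is finite exactly when 0 < r (for r <= 0 the value is 0). *)
Definition gamma_fun {R : realType} (r : R) : R :=
  \int[lebesgue_measure]_(x in `]0, +oo[) (x `^ (r - 1) * expR (- x)).

Definition gamma_pdf {R : realType} (r rate : R) : R -> R :=
  (fun x => rate `^ r / gamma_fun r * x `^ (r - 1) * expR (- rate * x))
    \_ `]0, +oo[.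

Definition gamma_prob {R : realType} (r rate : R) : set R -> \bar R :=
  fun A => (\int[lebesgue_measure]_(x in A) (gamma_pdf r rate x)%:E)%E.

Definition gamma_distributed {R : realType} {d : measure_display}
    {T : measurableType d} {P : probability T R} (X : {RV P >-> R})
    (r rate : R) : Prop :=
  forall A : set R, measurable A -> distribution P X A = gamma_prob r rate A.

Definition independent_RV2 {R : realType} {d : measure_display}
    {T : measurableType d} {P : probability T R} (X Y : {RV P >-> R}) : Prop :=
  forall A B : set R, measurable A -> measurable B ->
    P (X @^-1` A `&` Y @^-1` B) = (P (X @^-1` A) * P (Y @^-1` B))%E.

Definition median {R : realType} {d : measure_display}
    {T : measurableType d} {P : probability T R} (X : {RV P >-> R}) : R :=
  inf [set x : R | ((2^-1)%:E <= cdf X x)%E].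

(* Main.v *)
Require Import Defs.
From HB Require Import structures.
From mathcomp Require Import all_boot all_order all_algebra.
From mathcomp Require Import all_classical all_reals all_analysis.
From mathcomp Require Import measurable_realfun ring lra.

Set Implicit Arguments.
Unset Strict Implicit.
Unset Printing Implicit Defensive.

Import Order.TTheory GRing.Theory Num.Theory.
Import numFieldNormedType.Exports.
Local Open Scope classical_set_scope.
Local Open Scope ring_scope.

(** Write [al = 1 - th], [be = 1 + th] with [th = 1 - alpha], so that the variable
of interest is [Z = al * X1 + be * X2]. With [t = X2 / X1] and [y = X1 + X2],
the pair [(t, y)] has a density proportional to [w(t) * h(y)], where
[w(t) = t^(r-1) (1+t)^(-2r)] and [h(y) = y^(2r-1) exp(-y)], and
[Z = y / rho(t)] with [rho(t) = (1 + t) / (al + be * t)]. Hence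
[P(Z <= x)] is a constant times [F(th, x) = \int w(t) H(x rho(t)) dt], where
[H] is the primitive of [h] ([integral_ratio_sum], [probability_skew]).

The heart of the matter is that [F(., x)] is strictly increasing for [0 <= th < 1]
as long as [0 < x <= 2r], where [2r] is the common mean of all the [Z]
([skew_cdf_lt]). Differentiating under the integral sign, the derivative in
[th] is [S = \int w * slope]. No pointwise sign is available, but integrating
by parts (Stein's method) gives one: the function
[Psi(t) = t * w(t) * y * h(y)] at [y = x * rho(t)] vanishes at 0 and at
infinity, and in terms of [s = (be t - al) / (al + be t)] its derivative reads
[2 Psi' = C * w * slope - w * y h(y) * (z (s - th)^2 + th (2r - x))]
with [C > 0], [q = al * be] and [z = th x / q]. As [Psi'] has integral zero,
[C * S] is the integral of a nonnegative function that is not almost everywhere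
zero ([Rintegral_skew_slope_gt0]); this is where [x <= 2r] enters. In terms of
Bessel functions, it says that [I_(r+1/2)(z) / I_(r-1/2)(z) < th].

It remains to see that the medians in question lie in [(0, 2r]]. By
monotonicity in [th] it is enough to treat [th = 0], that is to say to know that
the median of a gamma law is at most its mean [k]
([gamma_median_le_mean]). After the substitution [y = k exp(v)] the density
becomes [exp(k (v - exp v))] up to a constant, and its value at [-v] is at least
its value at [v], because [2 v <= exp v - exp (- v)].

If now [0 < a < b < 1] and [m] is the median for [b], then the distribution
function for [a] exceeds that for [b] at [m], so it is larger than 1/2 there,
and, being continuous, already a little to the left of [m]. The symmetry
[alpha <-> 2 - alpha] is the exchangeability of [X1] and [X2], and it transports
the result from [(0, 1)] to [(1, 2)]. *)

(** * Rules of differentiation *)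

(** [is_derive] is a type class, for which instance search is triggered on every
subgoal; hiding it behind a constant leaves the choice of the rules to the
syntax-directed tactic [deriv]. *)
Definition has_deriv {R : realType} (f : R -> R) (x a : R) : Prop :=
  is_derive x 1 f a.

Section DerivativeRules.
Context {R : realType}.
Implicit Types (f g : R -> R) (x a b : R).

Lemma has_deriv_cst (c : R) x : has_deriv (fun _ : R => c) x 0.
Proof. exact: is_derive_cst. Qed.
Lemma has_deriv_id x : has_deriv (fun y : R => y) x 1.
Proof. exact: is_derive_id. Qed.
Lemma has_deriv_add f g x a b : has_deriv f x a -> has_deriv g x b ->
  has_deriv (fun y => f y + g y) x (a + b).
Proof. by move=> ? ?; exact: is_deriveD. Qed.
Lemma has_deriv_opp f x a : has_deriv f x a -> has_deriv (fun y => - f y) x (- a).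
Proof. by move=> ?; exact: is_deriveN. Qed.
Lemma has_deriv_mul f g x a b : has_deriv f x a -> has_deriv g x b ->
  has_deriv (fun y => f y * g y) x (a * g x + f x * b).
Proof.
rewrite /has_deriv => df dg; have := is_deriveM df dg.
set u := (X in is_derive _ _ _ X -> _); rewrite (_ : a * g x + f x * b = u)//.
by rewrite /u /GRing.scale/=; ring.
Qed.
Lemma has_deriv_inv f x a : f x != 0 -> has_deriv f x a ->
  has_deriv (fun y => (f y)^-1) x (- a / f x ^+ 2).
Proof.
rewrite /has_deriv => fx0 dfa; have := is_deriveV fx0 dfa.
set u := (X in is_derive _ _ _ X -> _); rewrite (_ : - a / f x ^+ 2 = u)//.
by rewrite /u /GRing.scale/=; ring.
Qed.
Lemma has_deriv_comp f g x a b : has_deriv f (g x) a -> has_deriv g x b ->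
  has_deriv (fun y => f (g y)) x (a * b).
Proof. by move=> ? ?; exact: (@is_derive1_comp _ f g). Qed.
Lemma has_deriv_expR f x a : has_deriv f x a ->
  has_deriv (fun y => expR (f y)) x (expR (f x) * a).
Proof. by move=> fa; apply: has_deriv_comp fa; exact: is_derive_expR. Qed.
Lemma has_deriv_ln f x a : 0 < f x -> has_deriv f x a ->
  has_deriv (fun y => ln (f y)) x (a / f x).
Proof.
move=> /is_derive1_ln dln fa; rewrite mulrC.
by apply: has_deriv_comp fa; exact: dln.
Qed.

Lemma has_deriv_eq f x a b : has_deriv f x a -> a = b -> has_deriv f x b.
Proof. by move=> ? <-. Qed.

Lemma has_deriv_derivable f x a : has_deriv f x a -> derivable f x 1.
Proof. by case. Qed.
Lemma has_deriv_derive1 f x a : has_deriv f x a -> (f^`())%classic x = a.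
Proof. by rewrite derive1E => -[]. Qed.
Lemma has_deriv_continuous f x a : has_deriv f x a -> {for x, continuous f}.
Proof.
by move=> /has_deriv_derivable ?; exact/differentiable_continuous/derivable1_diffP.
Qed.
End DerivativeRules.

(** Differentiates an explicit expression, leaving the side conditions of
logarithms and inverses. Partial applications such as [+%R 1] are eta-expanded
first, since they would escape the patterns. *)
Ltac deriv :=
  lazymatch goal with
  | |- has_deriv (fun _ => _) _ _ => idtac
  | |- has_deriv ?f ?x ?a => change (has_deriv (fun y => f y) x a)
  end;
  lazymatch goal with
  | |- has_deriv (fun y => y) _ _ => exact: has_deriv_id
  | |- has_deriv (fun y => expR (@?f y)) _ _ => apply: has_deriv_expR; deriv
  | |- has_deriv (fun y => ln (@?f y)) _ _ =>
      apply: (has_deriv_ln (f := f)); [|deriv]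
  | |- has_deriv (fun y => @?f y + @?g y) _ _ =>
      apply: (has_deriv_add (f := f) (g := g)); deriv
  | |- has_deriv (fun y => - @?f y) _ _ =>
      apply: (has_deriv_opp (f := f)); deriv
  | |- has_deriv (fun y => @?f y * @?g y) _ _ =>
      apply: (has_deriv_mul (f := f) (g := g)); deriv
  | |- has_deriv (fun y => (@?f y)^-1) _ _ =>
      apply: (has_deriv_inv (f := f)); [|deriv]
  | |- _ => first [exact: has_deriv_cst | eassumption | idtac]
  end.

(** * Integration on the half-line *)

(** Fundamental theorem of calculus on the half-line for an integrand that may be
singular at 0: it holds on [1/(n+2), n+2], and dominated convergence applies
because [phi] is integrable. *)
Lemma integral_derive_posline (R : realType) (Phi phi : R -> R) :
  (forall t, 0 < t -> has_deriv Phi t (phi t)) ->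
  (forall t : R, 0 < t -> {for t, continuous phi}) ->
  lebesgue_measure.-integrable `]0, +oo[ (EFin \o phi) ->
  Phi n.+2%:R @[n --> \oo] --> 0 -> Phi n.+2%:R^-1 @[n --> \oo] --> 0 ->
  \int[lebesgue_measure]_(t in `]0, +oo[) phi t = 0.
Proof.
move=> dPhi cphi iphi Phioo Phi0.
pose E n : set R := `[n.+2%:R^-1, n.+2%:R]%classic.
have E0 n t : E n t -> 0 < t.
  by rewrite /E/= in_itv/= => /andP[/(lt_le_trans _)+ _]; apply; rewrite invr_gt0.
have /integrableP[mphi _] := iphi.
have := @dominated_cvg _ _ _ (@lebesgue_measure R) `]0, +oo[ (measurable_itv _)
  (fun n => (EFin \o phi) \_ (E n)) (EFin \o phi) (abse \o (EFin \o phi)) _ _ _ _ _.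
have intE n : (\int[lebesgue_measure]_(t in `]0%R, +oo[)
   ((EFin \o phi) \_ (E n)) t = (Phi n.+2%:R - Phi n.+2%:R^-1)%:E)%E.
  rewrite -integral_mkcondr setIidr; last first.
    by move=> t Et /=; rewrite in_itv/= andbT; exact: E0 Et.
  have lt2 : n.+2%:R^-1 < n.+2%:R :> R.
    by rewrite (@lt_trans _ _ 1)// ?invf_lt1 ?ltr1n.
  have E0' t : t \in E n -> 0 < t by rewrite inE; exact: E0.
  rewrite (continuous_FTC2 (F := Phi) lt2) ?EFinB//.
  - apply: continuous_in_subspaceT => t /E0'; exact: cphi.
  - have cPhi (t : R) : 0 < t -> Phi x @[x --> t] --> Phi t.
      by move=> t0; exact: has_deriv_continuous (dPhi _ t0).
    split.
    + move=> t tE; apply: (has_deriv_derivable (dPhi _ _)).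
      by apply/E0'; rewrite inE; exact: subset_itv_oo_cc.
    + by apply: cvg_at_right_filter; apply: cPhi; rewrite invr_gt0.
    + by apply: cvg_at_left_filter; exact: cPhi.
  - move=> t tE; apply: (has_deriv_derive1 (dPhi _ _)).
    by apply/E0'; rewrite inE; exact: subset_itv_oo_cc.
under eq_cvg do rewrite intE.
move=> /(_ _ _ _ _ _)H.
have {}H : ((Phi n.+2%:R - Phi n.+2%:R^-1)%:E @[n --> \oo] -->
  \int[lebesgue_measure]_(t in `]0%R, +oo[) (EFin \o phi) t)%E.
  apply: H.
  - move=> n; apply/measurable_restrict; [exact: measurable_itv|exact: measurable_itv|].
    by apply: measurable_funS mphi => //; exact: measurable_itv.
  - move=> t; rewrite /= in_itv/= andbT => t0; apply: cvg_near_cst.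
    near=> n; rewrite patchE ifT// inE /E/= in_itv/=.
    rewrite -[X in _ <= X]invrK lef_pV2 ?posrE ?invr_gt0//.
    apply/andP; split.
    + rewrite (@le_trans _ _ n%:R)// ?ler_nat; last by rewrite -addn2 leq_addr.
      by near: n; exact: nbhs_infty_ger.
    + rewrite (@le_trans _ _ n%:R)// ?ler_nat; last by rewrite -addn2 leq_addr.
      by near: n; exact: nbhs_infty_ger.
  - by [].
  - exact: integrable_abse.
  - by move=> n t _; rewrite patchE; case: ifPn => // _; rewrite abse0 abse_ge0.
have H2 : ((Phi n.+2%:R - Phi n.+2%:R^-1)%:E @[n --> \oo] --> 0%:E)%E.
  apply: cvg_EFin; first exact: nearW.
  by rewrite -(subr0 0); apply: cvgB.
by rewrite /Rintegral -(cvg_unique _ H2 H).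
Unshelve. all: end_near. Qed.

(** * The densities of the ratio and of the sum *)

(** Up to a constant, the density of the ratio of two independent gamma variables
of shape [r]. *)
Definition ratio_weight {R : realType} (r t : R) : R :=
  expR ((r - 1) * ln t - 2 * r * ln (1 + t)).
(** On the positive half-line this is [y `^ (k - 1) * expR (- y)]; the exponential
form turns products of such densities into sums of logarithms. *)
Definition gamma_kernel {R : realType} (k y : R) : R :=
  expR ((k - 1) * ln y - y).
(** The quotient of [x1 + x2] by [(1 - th) * x1 + (1 + th) * x2], written as a
function of [t = x2 / x1]. *)
Definition rho {R : realType} (th t : R) : R :=
  (1 + t) / ((1 - th) + (1 + th) * t).
Definition lower_gamma {R : realType} (k x : R) : R :=
  \int[lebesgue_measure]_(y in `]0, x]) gamma_kernel k y.

Section Rho.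
Context {R : realType}.
Implicit Types r k t th x y e : R.

Lemma ratio_weight_gt0 r t : 0 < ratio_weight r t.
Proof. exact: expR_gt0. Qed.
Lemma gamma_kernel_gt0 k y : 0 < gamma_kernel k y.
Proof. exact: expR_gt0. Qed.

Lemma skew_den_gt0 th t : -1 < th -> th < 1 -> 0 < t -> 0 < (1 - th) + (1 + th) * t.
Proof. by move=> *; rewrite addr_gt0 ?mulr_gt0//; lra. Qed.

Lemma rho_gt0 th t : -1 < th -> th < 1 -> 0 < t -> 0 < rho th t.
Proof. by move=> t1 t2 t0; rewrite divr_gt0 ?skew_den_gt0// addr_gt0. Qed.

Lemma rho_bounds e th t : e < 1 -> -e <= th -> th <= e -> 0 < t ->
  (1 + e)^-1 <= rho th t <= (1 - e)^-1.
Proof.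
move=> e1 et te t0; have d0 : 0 < (1 - th) + (1 + th) * t by apply: skew_den_gt0; lra.
rewrite /rho ler_pdivlMr// ler_pdivrMr//.
rewrite -ler_pdivlMl ?invr_gt0 ?invrK; last lra.
rewrite -ler_pdivrMl ?invr_gt0 ?invrK; last lra.
by apply/andP; split; nra.
Qed.

Lemma has_deriv_ratio_weight r t : 0 < t -> has_deriv (ratio_weight r) t
  (ratio_weight r t * ((r - 1) / t - 2 * r / (1 + t))).
Proof.
move=> t0; rewrite /ratio_weight; apply: has_deriv_eq; first by deriv; rewrite /=; lra.
by congr (_ * _); field; lra.
Qed.

Lemma has_deriv_gamma_kernel k y : 0 < y -> has_deriv (gamma_kernel k) y
  (gamma_kernel k y * ((k - 1) / y - 1)).
Proof.
move=> y0; rewrite /gamma_kernel; apply: has_deriv_eq; first by deriv; rewrite /=; lra.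
by congr (_ * _); field; lra.
Qed.

Lemma has_deriv_rho_ratio th t : -1 < th -> th < 1 -> 0 < t ->
  has_deriv (rho th) t (- 2 * th / ((1 - th) + (1 + th) * t) ^+ 2).
Proof.
move=> t1 t2 t0; have d0 := skew_den_gt0 t1 t2 t0.
rewrite /rho; apply: has_deriv_eq; first by deriv; rewrite /= gt_eqF.
by rewrite /=; field; rewrite gt_eqF.
Qed.

Lemma has_deriv_rho_skew th t : -1 < th -> th < 1 -> 0 < t ->
  has_deriv (rho ^~ t) th ((1 + t) * (1 - t) / ((1 - th) + (1 + th) * t) ^+ 2).
Proof.
move=> t1 t2 t0; have d0 := skew_den_gt0 t1 t2 t0.
rewrite /rho; apply: has_deriv_eq; first by deriv; rewrite /= gt_eqF.
by rewrite /=; field; rewrite gt_eqF.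
Qed.

End Rho.

Section HalfLine.
Context {R : realType}.
Implicit Types r k t th x y e : R.
Notation mu := (@lebesgue_measure R).
Notation posline := (`]0%R, +oo[%classic : set R).

Lemma measurable_fun_posline (f : R -> R) :
  (forall t, 0 < t -> {for t, continuous f}) -> measurable_fun posline f.
Proof.
move=> cf; apply: open_continuous_measurable_fun; first exact: interval_open.
by move=> t; rewrite inE/= in_itv/= andbT; exact: cf.
Qed.

Lemma integrable_weighted (w B : R -> R) (M : R) :
  (forall t, 0 < t -> {for t, continuous B}) ->
  (forall t, 0 < t -> `|B t| <= M) ->
  mu.-integrable posline (EFin \o w) ->
  mu.-integrable posline (fun t => (w t * B t)%:E).
Proof.
move=> cB BM iw.
rewrite (_ : (fun t => _) = (EFin \o w) \* (EFin \o B))%E//.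
apply: integrableMl => //.
  exact: measurable_fun_posline.
exists M; split; first exact: num_real.
move=> N MN t; rewrite /= in_itv/= andbT => t0.
by rewrite (le_trans (BM _ t0))// ltW.
Qed.

Lemma Rintegral_gt0 (f : R -> R) :
  mu.-integrable posline (EFin \o f) ->
  (forall t, 0 < t -> 0 <= f t) -> (forall t, 1 < t -> 0 < f t) ->
  0 < \int[mu]_(t in posline) f t.
Proof.
move=> fi f0 f1.
rewrite lt_neqAle Rintegral_ge0 ?andbT; last first.
  by move=> t; rewrite /= in_itv/= andbT; exact: f0.
apply/eqP => /esym intf0.
have mf : measurable_fun posline (EFin \o f) by case/integrableP: fi.
have : (\int[mu]_(t in posline) `|(EFin \o f) t| = 0)%E.
  rewrite [RHS](_ : _ = (\int[mu]_(t in posline) f t)%:E); last by rewrite intf0.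
  rewrite /Rintegral fineK; last exact: integrable_fin_num.
  apply: eq_integral => t; rewrite inE/= in_itv/= andbT => t0.
  by rewrite ger0_norm// f0.
move=> /(ae_eq_integral_abs mu (measurable_itv _) mf)[N [mN N0 subN]].
(* [`[2, 3]] is any interval of positive length inside [`]1, +oo[]. *)
have : (mu `[2%R, 3%R] <= mu N)%E.
  apply: le_measure; rewrite ?inE//.
  move=> t; rewrite /= in_itv/= => /andP[t2 t3]; apply: subN => /=.
  rewrite in_itv/= andbT => H.
  have t0 : 0 < t by lra.
  have [] := H t0; apply/eqP; rewrite gt_eqF// f1//; lra.
by rewrite [X in (_ <= X)%E]N0 lebesgue_measure_itv/= lte_fin ltr_nat/= -EFinB lee_fin; lra.
Qed.

Lemma gamma_kernel_bounded k (a b : R) : 0 < a -> a <= b ->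
  exists2 M, 0 <= M & forall y, a <= y <= b -> gamma_kernel k y <= M.
Proof.
move=> a0 ab; have [|c _ cM] := @EVT_max _ (gamma_kernel k) a b ab.
  apply: continuous_in_subspaceT => y; rewrite inE/= in_itv/= => /andP[ay _].
  exact: has_deriv_continuous (has_deriv_gamma_kernel _ (lt_le_trans a0 ay)).
exists (gamma_kernel k c); first exact/ltW/gamma_kernel_gt0.
by move=> y yab; apply: cM; rewrite in_itv.
Qed.

Lemma lower_gamma_ge0 k x : 0 <= lower_gamma k x.
Proof. by apply: Rintegral_ge0 => y _; exact/ltW/gamma_kernel_gt0. Qed.

Section IntegrableKernel.
Variable k : R.
Hypothesis ik : mu.-integrable posline (EFin \o gamma_kernel k).

Let ik_sub x : mu.-integrable `]0, x] (EFin \o gamma_kernel k).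
Proof.
apply: integrableS ik; [exact: measurable_itv|exact: measurable_itv|].
by move=> y; rewrite /= !in_itv/= andbT => /andP[].
Qed.

Lemma has_deriv_lower_gamma x : 0 < x ->
  has_deriv (lower_gamma k) x (gamma_kernel k x).
Proof.
move=> x0.
have [||||] := @continuous_FTC1 R (gamma_kernel k) (BRight 0) x (x + 1).
- by rewrite ltrDl.
- exact: ik_sub.
- by [].
- exact: has_deriv_continuous (has_deriv_gamma_kernel _ x0).
by move=> d1 d2; split; [exact: d1|rewrite -derive1E; exact: d2].
Qed.

Lemma lower_gamma_le_total x :
  lower_gamma k x <= \int[mu]_(y in posline) gamma_kernel k y.
Proof.
apply: fine_le; [exact: integrable_fin_num|exact: integrable_fin_num|].
apply: ge0_subset_integral => //.
- by case/integrableP: ik.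
- by move=> y _; rewrite lee_fin ltW ?gamma_kernel_gt0.
- by move=> y; rewrite /= !in_itv/= andbT => /andP[].
Qed.

End IntegrableKernel.
End HalfLine.

(** * Derivative of the distribution function in the skewness parameter *)

(** Up to a constant, the distribution function of [(1 - th) * X1 + (1 + th) * X2]. *)
Definition skew_cdf {R : realType} (r th x : R) : R :=
  \int[lebesgue_measure]_(t in `]0, +oo[)
    (ratio_weight r t * lower_gamma (2 * r) (x * rho th t)).
(** The derivative in [th] of [lower_gamma (2 * r) (x * rho th t)]. *)
Definition skew_slope {R : realType} (r th x t : R) : R :=
  gamma_kernel (2 * r) (x * rho th t) *
  (x * ((1 + t) * (1 - t) / ((1 - th) + (1 + th) * t) ^+ 2)).

Section SkewDerivative.
Context {R : realType}.
Implicit Types t th x y e : R.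
Notation mu := (@lebesgue_measure R).
Notation posline := (`]0%R, +oo[%classic : set R).
Variable r : R.
Hypothesis iw : mu.-integrable posline (EFin \o ratio_weight r).
Hypothesis ik : mu.-integrable posline (EFin \o gamma_kernel (2 * r)).

Lemma skew_arg_bounds x e th t : 0 < x -> e < 1 -> -e <= th -> th <= e -> 0 < t ->
  x * (1 + e)^-1 <= x * rho th t <= x * (1 - e)^-1.
Proof. by move=> x0 e1 te et t0; rewrite !ler_pM2l//; exact: rho_bounds. Qed.

Lemma has_deriv_scale_rho x th t : -1 < th -> th < 1 -> 0 < t ->
  has_deriv (fun u => x * rho th u) t
    (x * (- 2 * th / ((1 - th) + (1 + th) * t) ^+ 2)).
Proof.
move=> t1 t2 t0; apply: has_deriv_eq.
  apply: (has_deriv_mul (f := fun=> x)); first exact: has_deriv_cst.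
  exact: has_deriv_rho_ratio.
by rewrite mul0r add0r.
Qed.

Lemma continuous_skew_slope x th t : 0 < x -> -1 < th -> th < 1 -> 0 < t ->
  {for t, continuous (skew_slope r th x)}.
Proof.
move=> x0 t1 t2 t0.
have d0 := skew_den_gt0 t1 t2 t0.
have y0 : 0 < x * rho th t by rewrite mulr_gt0 ?rho_gt0.
have h1 := has_deriv_scale_rho x t1 t2 t0.
have h2 := has_deriv_comp (g := fun u => x * rho th u) (has_deriv_gamma_kernel (2 * r) y0) h1.
have h3 : exists a, has_deriv
  (fun t => x * ((1 + t) * (1 - t) / ((1 - th) + (1 + th) * t) ^+ 2)) t a.
  eexists; rewrite /GRing.exp/=; deriv; rewrite /= ?mulf_neq0// gt_eqF//.
have [a {}h3] := h3.
exact: has_deriv_continuous (has_deriv_mul h2 h3).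
Qed.

(** For [th] in a compact part of [`]-1, 1[], [x * rho th t] stays in a fixed
compact part of the half-line whatever [t] is, so that the slope is bounded
uniformly in [t]. *)
Lemma skew_slope_bounded x e : 0 < x -> 0 <= e -> e < 1 -> exists2 M, 0 <= M &
  forall th t, -e <= th -> th <= e -> 0 < t -> `|skew_slope r th x t| <= M.
Proof.
move=> x0 e0 e1.
have e1' : 0 < 1 - e by lra.
have [||M M0 hM] := @gamma_kernel_bounded R (2 * r) (x * (1 + e)^-1) (x * (1 - e)^-1).
- by rewrite mulr_gt0 ?invr_gt0//; lra.
- by rewrite ler_pM2l// lef_pV2 ?posrE; lra.
exists (M * (x * (1 - e)^-1 ^+ 2)).
  by rewrite mulr_ge0// mulr_ge0 ?exprn_ge0 ?invr_ge0//; lra.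
move=> th t te et t0.
have t1 : -1 < th by lra.
have t2 : th < 1 by lra.
have d0 := skew_den_gt0 t1 t2 t0.
have := skew_arg_bounds x0 e1 te et t0.
rewrite /skew_slope normrM => /hM kM.
apply: ler_pM => //; first by rewrite gtr0_norm ?gamma_kernel_gt0.
rewrite normrM (gtr0_norm x0) ler_pM2l//.
apply: (@le_trans _ _ (rho th t ^+ 2)).
  rewrite /rho expr_div_n normrM [`|_^-1|]gtr0_norm; last first.
    by rewrite invr_gt0 exprn_gt0.
  rewrite ler_pM2r ?invr_gt0 ?exprn_gt0// normrM expr2 [`|1 + t|]gtr0_norm; last lra.
  by rewrite ler_pM2l ?ler_norml; [apply/andP; split; lra | lra].
have /andP[_ rhoe] := rho_bounds e1 te et t0.
by rewrite lerXn2r// nnegrE ltW// ?invr_gt0// rho_gt0.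
Qed.

Lemma integrable_skew_slope x th : 0 < x -> -1 < th -> th < 1 ->
  mu.-integrable posline (fun t => (ratio_weight r t * skew_slope r th x t)%:E).
Proof.
move=> x0 t1 t2.
have [||M _ hM] := @skew_slope_bounded x `|th| x0.
- exact: normr_ge0.
- by rewrite ltr_norml t1 t2.
apply: (@integrable_weighted _ _ _ M) => // t t0.
- exact: continuous_skew_slope.
- by apply: hM => //; [rewrite lerNl -normrN ler_norm|exact: ler_norm].
Qed.

Lemma has_deriv_skew_integrand x th t : 0 < x -> -1 < th -> th < 1 -> 0 < t ->
  has_deriv (fun th => ratio_weight r t * lower_gamma (2 * r) (x * rho th t)) th
    (ratio_weight r t * skew_slope r th x t).
Proof.
move=> x0 t1 t2 t0; apply: has_deriv_eq.
  apply: has_deriv_mul; first exact: has_deriv_cst.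
  apply: (has_deriv_comp (f := lower_gamma (2 * r)) (g := fun u => x * rho u t)).
    by apply: (has_deriv_lower_gamma ik); rewrite mulr_gt0 ?rho_gt0.
  apply: (has_deriv_mul (f := fun=> x)); first exact: has_deriv_cst.
  exact: has_deriv_rho_skew.
by rewrite /skew_slope; ring.
Qed.

Lemma continuous_skew_integrand x th t : 0 < x -> -1 < th -> th < 1 -> 0 < t ->
  {for t, continuous (fun t => lower_gamma (2 * r) (x * rho th t))}.
Proof.
move=> x0 t1 t2 t0; have y0 : 0 < x * rho th t by rewrite mulr_gt0 ?rho_gt0.
exact: has_deriv_continuous (has_deriv_comp (g := fun u => x * rho th u)
  (has_deriv_lower_gamma ik y0)
  (has_deriv_scale_rho x t1 t2 t0)).
Qed.

Lemma integrable_skew_integrand x th : 0 < x -> -1 < th -> th < 1 ->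
  mu.-integrable posline
    (fun t => (ratio_weight r t * lower_gamma (2 * r) (x * rho th t))%:E).
Proof.
move=> x0 t1 t2; apply: (@integrable_weighted _ _ _
    (\int[mu]_(y in posline) gamma_kernel (2 * r) y)) => // t t0.
- exact: continuous_skew_integrand.
- by rewrite ger0_norm ?lower_gamma_ge0//; exact: lower_gamma_le_total.
Qed.

(** Differentiation under the integral sign, dominated by a multiple of
[ratio_weight r] on the interval [`]-e, e[] around [th]. *)
Lemma has_deriv_skew_cdf x th : 0 < x -> -1 < th -> th < 1 ->
  has_deriv (skew_cdf r ^~ x) th
    (\int[mu]_(t in posline) (ratio_weight r t * skew_slope r th x t)).
Proof.
move=> x0 t1 t2.
(* Any number strictly between [`|th|] and 1 would do. *)
pose e := (1 + `|th|) / 2.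
have th1 : `|th| < 1 by rewrite ltr_norml t1 t2.
have th0 : 0 <= `|th| by exact: normr_ge0.
have [e0 e1 the] : [/\ 0 <= e, e < 1 & `|th| < e] by rewrite /e; split; lra.
have [M M0 hM] := skew_slope_bounded x0 e0 e1.
pose f th t := ratio_weight r t * lower_gamma (2 * r) (x * rho th t).
have mB : measurable (posline : set (measurableTypeR R)) := measurable_itv _.
have I1 (u : R) : u \in `]-e, e[ -> [/\ -1 < u, u < 1, -e <= u & u <= e].
  by rewrite in_itv/= => /andP[? ?]; split; lra.
have thI : `]-e, e[%classic th by rewrite /= in_itv/= -ltr_norml.
have dE (u t : R) : u \in `]-e, e[ -> 0 < t ->
    partial1of2 f u t = ratio_weight r t * skew_slope r u x t.
  by move=> /I1[? ? _ _] t0; apply: has_deriv_derive1; exact: has_deriv_skew_integrand.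
have intf (u : R) : `]-e, e[%classic u -> mu.-integrable posline (EFin \o f u).
  by move=> /I1[? ? _ _]; exact: integrable_skew_integrand.
have derf (u t : R) : `]-e, e[%classic u -> posline t -> derivable (f ^~ t) u 1.
  rewrite [posline t]/= in_itv/= andbT => /I1[? ? _ _] t0.
  apply: has_deriv_derivable; exact: has_deriv_skew_integrand.
have G0 (t : R) : 0 <= ratio_weight r t * M by rewrite mulr_ge0// ltW ?ratio_weight_gt0.
have iG : mu.-integrable posline (EFin \o (fun t => ratio_weight r t * M)).
  apply: (@integrable_weighted _ _ (cst M) `|M|) => // t t0; exact: cvg_cst.
have G_ub (u t : R) : `]-e, e[%classic u -> posline t ->
    `|partial1of2 f u t| <= ratio_weight r t * M.
  rewrite [posline t]/= in_itv/= andbT => uI t0; rewrite dE//.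
  have [? ? ? ?] := I1 _ uI.
  rewrite normrM gtr0_norm ?ratio_weight_gt0// ler_pM2l ?ratio_weight_gt0//.
  exact: hM.
have D := derivable_under_integral mB thI intf derf G0 iG G_ub.
split; first exact: D.
rewrite -derive1E (differentiation_under_integral mB thI intf derf G0 iG G_ub).
apply: eq_Rintegral => t; rewrite inE/= in_itv/= andbT => t0.
exact: dE.
Qed.

End SkewDerivative.

(** * Stein's identity and the sign of the derivative *)

Section SteinIdentity.
Context {R : realType}.
Implicit Types t th x y e u : R.
Notation mu := (@lebesgue_measure R).
Notation posline := (`]0%R, +oo[%classic : set R).
Variable r : R.
Hypothesis r0 : 0 < r.
Hypothesis iw : mu.-integrable posline (EFin \o ratio_weight r).
Hypothesis ik : mu.-integrable posline (EFin \o gamma_kernel (2 * r)).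

(** With its inverse counterpart below, this controls [t * ratio_weight r t] at both
ends of the half-line by the same quantity: it is [(t / (1 + t)^2) `^ r], which
is invariant under [t -> 1/t]. *)
Lemma scaled_ratio_weight_le u : 0 < u -> u * ratio_weight r u <= u `^ r.
Proof.
move=> u0; rewrite /powR gt_eqF// -[X in X * _]lnK ?posrE// /ratio_weight -expRD ler_expR.
have : 0 <= r * ln (1 + u) by rewrite mulr_ge0 ?ln_ge0 ?lerDl// ltW.
by move: (ln _) (ln _) => a b; lra.
Qed.

Lemma scaled_ratio_weight_inv_le u :
  0 < u -> u^-1 * ratio_weight r u^-1 <= u `^ r.
Proof.
move=> u0; have v0 : 0 < u^-1 by rewrite invr_gt0.
rewrite /powR gt_eqF// -[X in X * _]lnK ?posrE// /ratio_weight -expRD ler_expR.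
have : r * ln u^-1 <= r * ln (1 + u^-1).
  by rewrite ler_pM2l// ler_ln ?posrE ?lerDr ?addr_gt0.
by rewrite lnV ?posrE//; move: (ln _) (ln _) => a b; lra.
Qed.

(** Up to a constant, [t] times the conditional density of the ratio given
[Z = x]. In the variable [s = ((1 + th) t - (1 - th)) / ((1 - th) + (1 + th) t)],
the conditional density is proportional to [(1 - s^2)^(r-1) exp(z s)] and
[stein_fun] to [(1 - s^2)^r exp(z s)], with [z = th x / ((1 - th) (1 + th))]. *)
Definition stein_fun th x t : R := t * ratio_weight r t *
  (x * rho th t * gamma_kernel (2 * r) (x * rho th t)).
(** The remainder of Stein's identity, nonnegative for [0 <= th < 1] and [x <= 2 * r]:
a multiple of [(s - th)^2], plus the term [th * (2 * r - x)] that measures how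
far [x] is from the mean. *)
Definition stein_rest th x t : R :=
  x * rho th t * gamma_kernel (2 * r) (x * rho th t) *
  (th * x * ((1 - th) * (1 + th)) * ((t - 1) / ((1 - th) + (1 + th) * t)) ^+ 2
    + th * (2 * r - x)).
Let c th x : R := 2 * r * ((1 - th) * (1 + th)) + 2 * th ^+ 2 * x.

(** Completing the square in [s - th] isolates the slope, which is a multiple of
[th - s], from a remainder of constant sign when [x <= 2 * r]. *)
Lemma has_deriv_stein_fun x th t : 0 < x -> -1 < th -> th < 1 -> 0 < t ->
  has_deriv (stein_fun th x) t
    (ratio_weight r t * (2^-1 * (c th x * skew_slope r th x t - stein_rest th x t))).
Proof.
move=> x0 t1 t2 t0; have d0 := skew_den_gt0 t1 t2 t0.
have y0 : 0 < x * rho th t by rewrite mulr_gt0 ?rho_gt0.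
have h1 := has_deriv_scale_rho x t1 t2 t0.
have h2 := has_deriv_comp (g := fun u => x * rho th u)
  (has_deriv_gamma_kernel (2 * r) y0) h1.
have h3 := has_deriv_ratio_weight r t0.
apply: has_deriv_eq.
  exact: has_deriv_mul (has_deriv_mul (has_deriv_id t) h3) (has_deriv_mul h1 h2).
rewrite /c /stein_rest /skew_slope.
move: (gamma_kernel (2 * r) (x * rho th t)) (ratio_weight r t) => h w.
rewrite /rho in y0 *; field.
by rewrite !gt_eqF// addr_gt0.
Qed.

Lemma stein_rest_bounded x e : 0 < x -> 0 <= e -> e < 1 -> exists M,
  forall th t, 0 <= th -> th <= e -> 0 < t -> `|stein_rest th x t| <= M.
Proof.
move=> x0 e0 e1.
have rx : `|2 * r - x| <= 2 * r + x.
  by rewrite ler_norml; apply/andP; split; move: r0; lra.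
have e1' : 0 < 1 - e by lra.
have [||M M0 hM] := @gamma_kernel_bounded R (2 * r) (x * (1 + e)^-1) (x * (1 - e)^-1).
- by rewrite mulr_gt0 ?invr_gt0//; lra.
- by rewrite ler_pM2l// lef_pV2 ?posrE; lra.
exists (x * (1 - e)^-1 * M * (x * (1 - e)^-1 ^+ 2 + (2 * r + x))).
move=> th t th0 the t0.
have thN1 : -1 < th by lra.
have th1 : th < 1 by lra.
have the' : - e <= th by lra.
have d0 := skew_den_gt0 thN1 th1 t0.
have ye := skew_arg_bounds x0 e1 the' the t0.
have y0 : 0 < x * rho th t by rewrite mulr_gt0 ?rho_gt0.
rewrite /stein_rest normrM; apply: ler_pM => //.
  rewrite gtr0_norm; last by rewrite (mulr_gt0 y0)// gamma_kernel_gt0.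
  apply: ler_pM.
  - exact: ltW.
  - exact/ltW/gamma_kernel_gt0.
  - by case/andP: ye.
  - exact: hM.
have /andP[_ rhoe] := rho_bounds e1 the' the t0.
have sq : ((t - 1) / (1 - th + (1 + th) * t)) ^+ 2 <= (1 - e)^-1 ^+ 2.
  rewrite -[leLHS]ger0_norm ?sqr_ge0// normrX lerXn2r ?nnegrE ?invr_ge0 ?(ltW e1')//.
  apply: le_trans rhoe; rewrite normrM [`|_^-1|]gtr0_norm ?invr_gt0//.
  by rewrite /rho ler_pM2r ?invr_gt0// ler_norml; apply/andP; split; lra.
apply: le_trans (ler_normD _ _) _; apply: lerD.
  rewrite ger0_norm; last by rewrite mulr_ge0 ?sqr_ge0// !mulr_ge0//; lra.
  apply: ler_pM => //; [|exact: sqr_ge0|].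
    by rewrite !mulr_ge0//; lra.
  have : th * ((1 - th) * (1 + th)) <= 1 by nra.
  nra.
rewrite normrM ger0_norm//.
by apply: le_trans rx; rewrite ler_piMl//; lra.
Qed.

Lemma continuous_stein_rest x th t : 0 < x -> -1 < th -> th < 1 -> 0 < t ->
  {for t, continuous (stein_rest th x)}.
Proof.
move=> x0 t1 t2 t0; have d0 := skew_den_gt0 t1 t2 t0.
have y0 : 0 < x * rho th t by rewrite mulr_gt0 ?rho_gt0.
have h1 := has_deriv_scale_rho x t1 t2 t0.
have h2 := has_deriv_comp (g := fun u => x * rho th u)
  (has_deriv_gamma_kernel (2 * r) y0) h1.
have h3 : exists a, has_deriv (fun t => th * x * ((1 - th) * (1 + th)) *
    ((t - 1) / ((1 - th) + (1 + th) * t)) ^+ 2 + th * (2 * r - x)) t a.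
  by eexists; rewrite /GRing.exp/=; deriv; rewrite /= gt_eqF.
have [a {}h3] := h3.
exact: has_deriv_continuous (has_deriv_mul (has_deriv_mul h1 h2) h3).
Qed.

(** The derivative of [stein_fun] integrates to zero, so the integral of the slope
is a positive multiple of that of the remainder. *)
Lemma Rintegral_skew_slope_gt0 x th : 0 < x -> x <= 2 * r -> 0 < th -> th < 1 ->
  0 < \int[mu]_(t in posline) (ratio_weight r t * skew_slope r th x t).
Proof.
move=> x0 x2r th0 th1.
have thN1 : -1 < th by lra.
have [M hM] := @stein_rest_bounded x th x0 (ltW th0) th1.
have iS := integrable_skew_slope iw x0 thN1 th1.
have iP : mu.-integrable posline
    (fun t => (ratio_weight r t * stein_rest th x t)%:E).
  apply: (@integrable_weighted _ _ _ M) => // t t0; last by apply: hM => //; exact: ltW.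
  exact: continuous_stein_rest.
have P0 : 0 < \int[mu]_(t in posline) (ratio_weight r t * stein_rest th x t).
  have rest_factor t : 0 < t -> 0 < x * rho th t * gamma_kernel (2 * r) (x * rho th t).
    by move=> t0; rewrite mulr_gt0 ?gamma_kernel_gt0// mulr_gt0// rho_gt0.
  apply: Rintegral_gt0 => // t t0.
    apply: mulr_ge0; first exact/ltW/ratio_weight_gt0.
    apply: mulr_ge0; first exact/ltW/rest_factor.
    apply: addr_ge0; apply: mulr_ge0; [|exact: sqr_ge0|lra|lra].
    by rewrite !mulr_ge0//; lra.
  have t0' : 0 < t by lra.
  rewrite mulr_gt0 ?ratio_weight_gt0// /stein_rest mulr_gt0 ?rest_factor//.
  rewrite ltr_pwDl ?mulr_ge0//; [|lra|lra].
  rewrite mulr_gt0 ?exprn_gt0 ?divr_gt0 ?skew_den_gt0//; last lra.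
  by rewrite !mulr_gt0//; lra.
have c0 : 0 < c th x.
  by rewrite /c addr_gt0// !mulr_gt0 ?exprn_gt0//; lra.
have mB : measurable (posline : set (measurableTypeR R)) := measurable_itv _.
have iS' : mu.-integrable posline (fun t => (c th x * (ratio_weight r t *
    skew_slope r th x t))%:E) by exact: (integrableZl mB (c th x) iS).
have iD : mu.-integrable posline (fun t => (c th x * (ratio_weight r t *
    skew_slope r th x t) - ratio_weight r t * stein_rest th x t)%:E).
  by have := integrableB mB iS' iP.
have [K K0 hK] : exists2 K, 0 <= K & forall t, 0 < t ->
    `|stein_fun th x t| <= t * ratio_weight r t * K.
  have th1' : 0 < 1 - th by lra.
  have [||K K0 hK] := @gamma_kernel_bounded R (2 * r) (x * (1 + th)^-1) (x * (1 - th)^-1).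
  - by rewrite mulr_gt0 ?invr_gt0//; lra.
  - by rewrite ler_pM2l// lef_pV2 ?posrE; lra.
  exists (x * (1 - th)^-1 * K); first by rewrite mulr_ge0// ltW// divr_gt0.
  move=> t t0; have wt0 := ratio_weight_gt0 r t.
  have thN : - th <= th by lra.
  have ye := skew_arg_bounds x0 th1 thN (lexx th) t0.
  have y0 : 0 < x * rho th t by rewrite mulr_gt0 ?rho_gt0.
  have h0 := gamma_kernel_gt0 (2 * r) (x * rho th t).
  rewrite gtr0_norm; last by rewrite /stein_fun mulr_gt0// mulr_gt0.
  rewrite /stein_fun ler_pM2l ?mulr_gt0//.
  apply: ler_pM (ltW y0) (ltW h0) _ (hK _ ye).
  by case/andP: ye.
have stein0 (u : R^nat) : (forall n, 0 < u n) ->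
    (forall n, u n * ratio_weight r (u n) <= n.+2%:R^-1 `^ r) ->
    stein_fun th x (u n) @[n --> \oo] --> 0.
  move=> u0 ule.
  have inv0 : (n.+2%:R^-1 `^ r * K) @[n --> \oo] --> (0 : R).
    rewrite -(mul0r K); apply: cvgM; last exact: cvg_cst.
    have /cvg_at_rightP := powR_cvg0 r0; apply; split => [n|].
      by rewrite invr_gt0.
    by have := @cvg_harmonic R; rewrite -cvg_shiftS.
  apply: norm_cvg0; apply: squeeze_cvgr (cvg_cst 0) inv0.
  apply: nearW => n; rewrite normr_ge0/=.
  by rewrite (le_trans (hK _ (u0 n)))// ler_wpM2r.
have vanish : \int[mu]_(t in posline) (2^-1 * (c th x *
  (ratio_weight r t * skew_slope r th x t) - ratio_weight r t * stein_rest th x t)) = 0.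
  apply: (@integral_derive_posline _ (stein_fun th x)).
  - move=> t t0; apply: has_deriv_eq; first exact: has_deriv_stein_fun.
    ring.
  - move=> t t0.
    have cw := has_deriv_continuous (has_deriv_ratio_weight r t0).
    have cs := continuous_skew_slope (r := r) x0 thN1 th1 t0.
    have cr := continuous_stein_rest x0 thN1 th1 t0.
    apply: cvgM; first exact: cvg_cst.
    apply: cvgB; last exact: cvgM cw cr.
    by apply: cvgM; [exact: cvg_cst|exact: cvgM cw cs].
  - exact: (integrableZl mB 2^-1 iD).
  - apply: stein0 => n //; rewrite ?ltr0n//.
    by rewrite -[X in X * ratio_weight r X]invrK scaled_ratio_weight_inv_le// invr_gt0.
  - apply: stein0 => n; first by rewrite invr_gt0.
    by rewrite scaled_ratio_weight_le// invr_gt0.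
move: vanish.
rewrite RintegralZl// RintegralB//.
rewrite RintegralZl//.
move: P0; set P := Rintegral _ _ _ => P0.
set S := Rintegral _ _ _ => H.
have /esym cS : c th x * S = P by lra.
by rewrite -(pmulr_rgt0 _ c0) -cS.
Qed.
End SteinIdentity.

(** * Median of the gamma law and monotonicity in the skewness *)

Section Monotonicity.
Context {R : realType}.
Implicit Types t th x y e u v k : R.
Notation mu := (@lebesgue_measure R).
Notation posline := (`]0%R, +oo[%classic : set R).

Lemma has_deriv_ge0_le (f : R -> R) (f' : R -> R) (a b : R) : a <= b ->
  (forall x, a <= x <= b -> has_deriv f x (f' x)) ->
  (forall x, a < x < b -> 0 <= f' x) -> f a <= f b.
Proof.
move=> ab df f'0; apply: (@ger0_derive1_le_cc _ f a b) => //.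
- move=> x; rewrite in_itv/= => /andP[ax xb].
  by apply: has_deriv_derivable (df _ _); rewrite !ltW.
- move=> x; rewrite in_itv/= => /andP[ax xb].
  by rewrite (has_deriv_derive1 (df x _)) ?f'0 ?ax ?xb ?ltW.
- apply: continuous_in_subspaceT => x; rewrite inE/= in_itv/= => xab.
  exact: has_deriv_continuous (df x xab).
- by rewrite in_itv/= lexx ab.
- by rewrite in_itv/= lexx ab.
Qed.

Lemma has_deriv_gt0_lt (f : R -> R) (f' : R -> R) (a b : R) : a < b ->
  (forall x, a <= x <= b -> has_deriv f x (f' x)) ->
  (forall x, a < x < b -> 0 < f' x) -> f a < f b.
Proof.
move=> ab df f'0; apply: (@gtr0_derive1_lt_cc _ f a b) => //.
- move=> x; rewrite in_itv/= => /andP[ax xb].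
  by apply: has_deriv_derivable (df _ _); rewrite !ltW.
- move=> x; rewrite in_itv/= => /andP[ax xb].
  by rewrite (has_deriv_derive1 (df x _)) ?f'0 ?ax ?xb ?ltW.
- apply: continuous_in_subspaceT => x; rewrite inE/= in_itv/= => xab.
  exact: has_deriv_continuous (df x xab).
- by rewrite in_itv/= lexx ltW.
- by rewrite in_itv/= lexx ltW.
Qed.

Lemma expR_sub_ge v : 0 <= v -> 2 * v <= expR v - expR (- v).
Proof.
move=> v0; rewrite -subr_ge0.
pose f u := expR u - expR (- u) - 2 * u.
suff : f 0 <= f v by rewrite /f oppr0 subrr mulr0 subr0.
apply: (has_deriv_ge0_le (f' := fun u => expR u + expR (- u) - 2)) => // u _.
  by rewrite /f; apply: has_deriv_eq; [deriv | rewrite /=; ring].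
by have := expR_ge1Dx u; have := expR_ge1Dx (- u); lra.
Qed.

Section GammaMedian.
Variable k : R.
Hypothesis k0 : 0 < k.
Hypothesis ik : mu.-integrable posline (EFin \o gamma_kernel k).

(** The left-hand side decreases in [v]: with [y = k * expR v] its derivative is the
difference of [y * gamma_kernel k y = expR (k * ln k + k * (v - expR v))] at [v]
and at [- v], and [expR_sub_ge] compares the exponents. *)
Lemma lower_gamma_reflect v : 0 <= v ->
  lower_gamma k (k * expR v) + lower_gamma k (k * expR (- v)) <= 2 * lower_gamma k k.
Proof.
move=> v0.
pose J u := - (lower_gamma k (k * expR u) + lower_gamma k (k * expR (- u))).
suff : J 0 <= J v by rewrite /J oppr0 expR0 mulr1 lerN2 mulr_natl mulr2n.
pose h y := y * gamma_kernel k y.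
apply: (has_deriv_ge0_le (f := J)
  (f' := fun u => h (k * expR (- u)) - h (k * expR u))) => // u /andP[u0 _].
  have d1 : has_deriv (fun u => k * expR u) u (k * expR u).
    by apply: has_deriv_eq; [deriv | rewrite /=; ring].
  have d2 : has_deriv (fun u => k * expR (- u)) u (- (k * expR (- u))).
    by apply: has_deriv_eq; [deriv | rewrite /=; ring].
  apply: has_deriv_eq.
    apply: has_deriv_opp; apply: has_deriv_add.
      apply: (has_deriv_comp (f := lower_gamma k) (g := fun u => k * expR u)) d1.
      by apply: (has_deriv_lower_gamma ik); rewrite mulr_gt0 ?expR_gt0.
    apply: (has_deriv_comp (f := lower_gamma k) (g := fun u => k * expR (- u))) d2.
    by apply: (has_deriv_lower_gamma ik); rewrite mulr_gt0 ?expR_gt0.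
  by rewrite /h /=; ring.
have hE w : h (k * expR w) = expR (k * ln k + k * (w - expR w)).
  have kw0 : 0 < k * expR w by rewrite mulr_gt0 ?expR_gt0.
  rewrite /h /gamma_kernel -[X in X * _]lnK ?posrE// -expRD; congr expR.
  by rewrite lnM ?posrE ?expR_gt0// expRK; ring.
rewrite subr_ge0 !hE ler_expR lerD2l ler_pM2l//.
by have := expR_sub_ge (ltW u0); lra.
Qed.

Lemma lower_gamma_cvg : lower_gamma k n%:R @[n --> \oo] -->
  \int[mu]_(y in posline) gamma_kernel k y.
Proof.
apply: fine_cvg; rewrite /Rintegral fineK; last exact: integrable_fin_num.
have -> : posline = \bigcup_n `]0, n%:R]%classic.
  apply/seteqP; split => y /=.
    rewrite in_itv/= andbT => y0; exists (Num.truncn y).+1 => //=.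
    by rewrite in_itv/= y0/= ltW// truncnS_gt.
  by case=> n _ /=; rewrite !in_itv/= => /andP[-> _].
apply: ge0_nondecreasing_set_cvg_integral => //.
- move=> m n mn; apply/subsetPset => y; rewrite /= !in_itv/= => /andP[->/=].
  by move=> /le_trans; apply; rewrite ler_nat.
- move=> n; case/integrableP: ik => mk _; apply: measurable_funS mk => //.
  by move=> y; rewrite /= !in_itv/= => /andP[->].
- by move=> n y _; rewrite lee_fin ltW ?gamma_kernel_gt0.
Qed.

(** Let [v] tend to infinity in [lower_gamma_reflect]. *)
Lemma gamma_median_le_mean :
  \int[mu]_(y in posline) gamma_kernel k y <= 2 * lower_gamma k k.
Proof.
have H := lower_gamma_cvg.
rewrite -(cvg_lim _ H)//; apply: limr_le; first by apply/cvg_ex; eexists; exact: H.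
near=> n.
have kn : k <= n%:R by near: n; exact: nbhs_infty_ger.
have n0 : 0 < n%:R :> R by exact: lt_le_trans kn.
have := lower_gamma_reflect (v := ln (n%:R / k)).
rewrite ln_ge0 ?lnK ?posrE ?divr_gt0 ?ler_pdivlMr ?mul1r// => /(_ isT).
rewrite mulrC divfK ?gt_eqF//; apply: le_trans.
by rewrite lerDl lower_gamma_ge0.
Unshelve. all: end_near. Qed.

End GammaMedian.

Section Skew.
Variable r : R.
Hypothesis r0 : 0 < r.
Hypothesis iw : mu.-integrable posline (EFin \o ratio_weight r).
Hypothesis ik : mu.-integrable posline (EFin \o gamma_kernel (2 * r)).

Lemma skew_cdf_lt x a b : 0 < x -> x <= 2 * r -> 0 <= a -> a < b -> b < 1 ->
  skew_cdf r a x < skew_cdf r b x.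
Proof.
move=> x0 x2r a0 ab b1.
apply: (has_deriv_gt0_lt (f := skew_cdf r ^~ x) (f' := fun th =>
  \int[mu]_(t in posline) (ratio_weight r t * skew_slope r th x t))) => // th /andP[ath thb].
  by apply: has_deriv_skew_cdf => //; lra.
by apply: Rintegral_skew_slope_gt0 => //; lra.
Qed.

Lemma skew_cdf0 x :
  skew_cdf r 0 x = (\int[mu]_(t in posline) ratio_weight r t) * lower_gamma (2 * r) x.
Proof.
have mB : measurable (posline : set (measurableTypeR R)) := measurable_itv _.
rewrite -(RintegralZr (lower_gamma (2 * r) x) mB iw).
apply: eq_Rintegral => t; rewrite inE/= in_itv/= andbT => t0.
by rewrite /rho subr0 addr0 mul1r divff ?mulr1// gt_eqF// addr_gt0.
Qed.

Lemma continuous_skew_cdf th x : 0 < x -> -1 < th -> th < 1 ->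
  {for x, continuous (skew_cdf r th)}.
Proof.
move=> x0 t1 t2.
pose f x t := ratio_weight r t * lower_gamma (2 * r) (x * rho th t).
pose M := \int[mu]_(y in posline) gamma_kernel (2 * r) y.
have mB : measurable (posline : set (measurableTypeR R)) := measurable_itv _.
have I0 (u : R) : `]0%R, 2 * x[%classic u -> 0 < u by rewrite /= in_itv/= => /andP[].
have intf (u : R) : `]0%R, 2 * x[%classic u -> mu.-integrable posline (EFin \o f u).
  by move=> /I0 u0; exact: integrable_skew_integrand.
have cf : {ae mu, forall t, posline t -> {in `]0%R, 2 * x[%classic, continuous (f ^~ t)}}.
  apply: aeW => t; rewrite /= in_itv/= andbT => t0 u; rewrite inE => /I0 u0.
  apply: (has_deriv_continuous (x := u)).
  apply: (has_deriv_mul (f := fun=> ratio_weight r t)); first exact: has_deriv_cst.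
  apply: (has_deriv_comp (f := lower_gamma (2 * r)) (g := fun u => u * rho th t)).
    by apply: (has_deriv_lower_gamma ik); rewrite mulr_gt0 ?rho_gt0.
  apply: (has_deriv_mul (f := fun u => u)); [exact: has_deriv_id|exact: has_deriv_cst].
have iG : mu.-integrable posline (EFin \o (fun t => ratio_weight r t * M)).
  by apply: (@integrable_weighted _ _ (cst M) `|M|) => // t t0; exact: cvg_cst.
have G_ub (u : R) : `]0%R, 2 * x[%classic u ->
    {ae mu, forall t, posline t -> `|f u t| <= ratio_weight r t * M}.
  move=> _; apply: aeW => t _.
  rewrite normrM gtr0_norm ?ratio_weight_gt0// ler_pM2l ?ratio_weight_gt0//.
  by rewrite ger0_norm ?lower_gamma_ge0//; exact: lower_gamma_le_total.
have := continuity_under_integral mB intf cf iG G_ub.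
apply; rewrite inE/= in_itv/= x0/=; lra.
Qed.
End Skew.
End Monotonicity.

(** * Joint densities and changes of variables *)

Section DensityMeasure.
Local Open Scope ereal_scope.
Context d (T : measurableType d) (R : realType).
Variables (mu : {measure set T -> \bar R}) (f : T -> \bar R).
Hypotheses (mf : measurable_fun setT f) (f0 : forall x, 0 <= f x).

(** The hypotheses on [f] are arguments so that the measure structure can be attached
to the constant. *)
Definition density_measure of measurable_fun setT f & (forall x, 0 <= f x) :=
  fun A : set T => \int[mu]_(x in A) f x.

Let nu := density_measure mf f0.

Let nu0 : nu set0 = 0. Proof. exact: integral_set0. Qed.

Let nu_ge0 A : 0 <= nu A. Proof. exact: integral_ge0. Qed.

Let nu_sigma_additive : semi_sigma_additive nu.
Proof.
move=> F mF tF mUF; rewrite /nu /density_measure ge0_integral_bigcup//.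
- by apply: is_cvg_nneseries => n _ _; exact: integral_ge0.
- exact: measurable_funTS.
Qed.

HB.instance Definition _ := isMeasure.Build _ _ _ nu nu0 nu_ge0 nu_sigma_additive.
End DensityMeasure.

Section Joint.
Local Open Scope ereal_scope.
Context {R : realType}.
Notation mu := (@lebesgue_measure R).
Notation mR := (measurableTypeR R).

(** On rectangles, the joint law, the product of the laws and the measure with
density [f x * g y] agree, and the product measure is characterised by its
values on rectangles. *)
Lemma joint_density d (T : measurableType d) (P : probability T R)
  (X Y : T -> mR) (f g : mR -> \bar R) :
  measurable_fun setT X -> measurable_fun setT Y ->
  measurable_fun setT f -> (forall x, 0 <= f x) ->
  measurable_fun setT g -> (forall x, 0 <= g x) ->
  (forall B, measurable B -> P (X @^-1` B) = \int[mu]_(x in B) f x) ->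
  (forall B, measurable B -> P (Y @^-1` B) = \int[mu]_(x in B) g x) ->
  (forall B C, measurable B -> measurable C ->
    P (X @^-1` B `&` Y @^-1` C) = P (X @^-1` B) * P (Y @^-1` C)) ->
  forall A : set (mR * mR), measurable A ->
    P [set w | A (X w, Y w)] =
    \int[mu]_x \int[mu]_y ((\1_A (x, y))%:E * (f x * g y)).
Proof.
move=> mX mY mf f0 mg g0 Xf Yg ind A mA.
pose X' : {mfun T >-> mR} := HB.pack X (isMeasurableFun.Build _ _ _ _ X mX).
pose Y' : {mfun T >-> mR} := HB.pack Y (isMeasurableFun.Build _ _ _ _ Y mY).
pose XY w := (X w, Y w).
have mXY : measurable_fun setT XY by exact: measurable_fun_pair.
pose XY' : {mfun T >-> (mR * mR)%type} := HB.pack XY (isMeasurableFun.Build _ _ _ _ XY mXY).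
pose F (z : mR * mR) := f z.1 * g z.2.
have F0 z : 0 <= F z by exact: mule_ge0.
have mF : measurable_fun setT F.
  by apply: emeasurable_funM; exact: measurableT_comp.
have FE (B : set (mR * mR)) : measurable B -> \int[mu \x mu]_(z in B) F z =
    \int[mu]_x \int[mu]_y ((\1_B (x, y))%:E * (f x * g y)).
  move=> mB; rewrite integral_mkcond.
  rewrite (_ : F \_ B = fun z => (\1_B z)%:E * F z); last first.
    apply/funext => z; rewrite patchE indicE; case: ifPn => _.
      by rewrite mul1e.
    by rewrite mul0e.
  rewrite fubini_tonelli1//.
  - apply: emeasurable_funM => //; apply/measurable_EFinP; exact: measurable_indic.
  - by move=> z; rewrite mule_ge0// lee_fin indicE.
have e1 : (distribution P X' \x distribution P Y') A = P (XY @^-1` A).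
  refine (@product_measure_unique _ _ _ _ _ (distribution P X') (distribution P Y')
    (distribution P XY') _ A mA) => B C mB mC.
  exact: ind.
have e2 : (distribution P X' \x distribution P Y') A = density_measure (mu \x mu) mF F0 A.
  refine (@product_measure_unique _ _ _ _ _ (distribution P X') (distribution P Y')
    (density_measure (mu \x mu) mF F0) _ A mA) => B C mB mC.
  rewrite [LHS]FE; last exact: measurableX.
  transitivity ((\int[mu]_(x in B) f x) * (\int[mu]_(y in C) g y)); last first.
    by rewrite -Xf// -Yg.
  transitivity (\int[mu]_x ((\1_B x)%:E * f x * \int[mu]_(y in C) g y)).
    apply: eq_integral => x _.
    rewrite [\int[mu]_(y in C) _]integral_mkcond -ge0_integralZl//; last 3 first.
    - by apply/(measurable_restrictT g) => //; exact: measurable_funTS.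
    - by move=> y _; exact: erestrict_ge0.
    - by rewrite mule_ge0// lee_fin indicE.
    apply: eq_integral => y _; rewrite patchE !indicE in_setX/=.
    by case: (x \in B); case: (y \in C); rewrite ?mul1e ?mul0e ?mule0.
  rewrite ge0_integralZr//.
  - congr (_ * _); rewrite [RHS]integral_mkcond; apply: eq_integral => x _.
    by rewrite patchE indicE; case: (x \in B); rewrite ?mul1e ?mul0e.
  - by apply: emeasurable_funM => //; apply/measurable_EFinP; exact: measurable_indic.
  - by move=> x _; rewrite mule_ge0// lee_fin indicE.
  - exact: integral_ge0.
rewrite -FE//; transitivity ((distribution P X' \x distribution P Y') A); first exact/esym.
exact: e2.
Qed.
End Joint.

Section Scale.
Local Open Scope ereal_scope.
Context {R : realType}.
Notation mu := (@lebesgue_measure R).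
Notation mR := (measurableTypeR R).

(** Lebesgue measure is [k] times its image under [x -> k * x]: by uniqueness, it is
enough to compare the two measures on intervals. *)
Lemma ge0_integral_scale (k : R) (f : mR -> \bar R) : (0 < k)%R ->
  measurable_fun setT f -> (forall x, 0 <= f x) ->
  \int[mu]_x f x = k%:E * \int[mu]_x f (k * x)%R.
Proof.
move=> k0 mf f0.
pose phi (x : mR) : mR := (k * x)%R.
have mphi : measurable_fun setT phi by exact: measurable_funM.
pose phi' : {mfun mR >-> mR} := HB.pack phi (isMeasurableFun.Build _ _ _ _ phi mphi).
have scaleE (A : set mR) : measurable A ->
    mu A = mscale (NngNum (ltW k0)) (pushforward mu phi') A.
  move=> mA; apply: lebesgue_measure_unique => // _ [[a b]] _ <-.
  transitivity (k%:E * mu `](a / k)%R, (b / k)%R]%classic); last first.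
    congr (_ * mu _); apply/seteqP; split => x /=; rewrite !in_itv/= /phi;
      by rewrite ltr_pdivrMr// ler_pdivlMr// ![(_ * k)%R]mulrC.
  rewrite !lebesgue_measure_itv/= !lte_fin ltr_pM2r ?invr_gt0//.
  case: ifPn => _; last by rewrite mule0.
  by rewrite -!EFinB -EFinM -mulrBl mulrC divfK ?gt_eqF//.
rewrite (eq_measure_integral (mscale (NngNum (ltW k0)) (pushforward mu phi'))); last first.
  by move=> A mA _; exact: scaleE.
rewrite ge0_integral_mscale//.
by rewrite ge0_integral_pushforward.
Qed.
End Scale.

Section Polar.
Context {R : realType}.
Implicit Types r t x y k c : R.
Notation mu := (@lebesgue_measure R).
Notation mR := (measurableTypeR R).
Notation posline := (`]0%R, +oo[%classic : set R).

Lemma gamma_pdf_pos r x : 0 < x ->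
  gamma_pdf r 1 x = (gamma_fun r)^-1 * gamma_kernel r x.
Proof.
move=> x0; rewrite /gamma_pdf patchE mem_set ?[posline x]/= ?in_itv/= ?x0//.
rewrite powR1 mul1r -mulrA; congr (_ * _).
by rewrite /powR gt_eqF// -expRD mulN1r.
Qed.

Lemma gamma_pdf_npos r x : x <= 0 -> gamma_pdf r 1 x = 0.
Proof.
move=> x0; rewrite /gamma_pdf patchE memNset//= in_itv/= andbT.
by apply/negP; rewrite -leNgt.
Qed.

Lemma gamma_fun_ge0 r : 0 <= gamma_fun r.
Proof. by apply: Rintegral_ge0 => x _; rewrite mulr_ge0 ?powR_ge0 ?expR_ge0. Qed.

Lemma gamma_pdf_ge0 r x : 0 <= gamma_pdf r 1 x.
Proof.
have [x0|x0] := ltP 0 x; last by rewrite gamma_pdf_npos.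
by rewrite gamma_pdf_pos// mulr_ge0 ?invr_ge0 ?gamma_fun_ge0// ltW ?gamma_kernel_gt0.
Qed.

Lemma measurable_gamma_pdf r : measurable_fun (setT : set mR) (gamma_pdf r 1 : mR -> R).
Proof.
pose q (x : mR) : R := 1 `^ r / gamma_fun r * x `^ (r - 1) * expR (- 1 * x).
apply/(measurable_restrictT q) => //; apply: measurable_funTS.
apply: measurable_funM; first exact: measurable_funM.
by apply: measurableT_comp => //; exact: measurable_funM.
Qed.

(** The Jacobian of [(x1, x2) -> (t, y) = (x2 / x1, x1 + x2)] and the two gamma
densities combine into a product: ratio and sum are independent. The two outer
factors on the left are those of the substitutions [x2 = x1 * t] and
[x1 = y / (1 + t)]. *)
Lemma gamma_kernel_ratio r t y : 0 < t -> 0 < y ->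
  (1 + t)^-1 * (y / (1 + t) *
    (gamma_kernel r (y / (1 + t)) * gamma_kernel r (y / (1 + t) * t))) =
  ratio_weight r t * gamma_kernel (2 * r) y.
Proof.
move=> t0 y0; have t1 : 0 < 1 + t by rewrite addr_gt0.
rewrite -[X in X * _ = _]lnK ?posrE ?invr_gt0//.
rewrite -[X in _ * (X * _) = _]lnK ?posrE ?divr_gt0//.
rewrite /gamma_kernel /ratio_weight -!expRD; congr expR.
rewrite !lnM ?posrE ?divr_gt0 ?invr_gt0// !lnV ?posrE//.
have : y / (1 + t) + y / (1 + t) * t = y by field; rewrite gt_eqF.
move: (ln y) (ln t) (ln (1 + t)) (y / (1 + t)) => a b c s <-.
by ring.
Qed.

Local Open Scope ereal_scope.

(** Change of variables to the ratio [t] and the sum [y], made of one-dimensional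
scalings only: [x2 = x1 * t] for fixed [x1], an exchange of the integrals, then
[x1 = y / (1 + t)] for fixed [t]. *)
Lemma integral_ratio_sum r (A : set (mR * mR)) : measurable A ->
  \int[mu]_x \int[mu]_y
    ((\1_A (x, y))%:E * ((gamma_pdf r 1 x)%:E * (gamma_pdf r 1 y)%:E)) =
  \int[mu]_(t in posline) \int[mu]_(y in posline)
    (\1_A ((y / (1 + t))%R, (y / (1 + t) * t)%R) *
      ((gamma_fun r)^-1 ^+ 2 * (ratio_weight r t * gamma_kernel (2 * r) y)))%:E.
Proof.
move=> mA; pose p := gamma_pdf r 1 : mR -> R.
have mp : measurable_fun setT p := measurable_gamma_pdf r.
have p0 x : (0 <= p x)%R := gamma_pdf_ge0 r x.
pose phi (x y : mR) : R := (\1_A (x, y) * (p x * p y))%R.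
have phi0 x y : (0 <= phi x y)%R by rewrite !mulr_ge0// indicE.
have mphi : measurable_fun (setT : set (mR * mR)) (fun z => phi z.1 z.2).
  apply: measurable_funM; last first.
    by apply: measurable_funM; exact: measurableT_comp.
  rewrite (_ : (fun _ => _) = \1_A); first exact: measurable_indic.
  by apply/funext => -[].
(* The Jacobian is written [`|x|] to keep the integrand nonnegative on the whole
   line; [phi] vanishes for [x <= 0]. *)
pose psi (x t : mR) : R := (`|x| * phi x (x * t))%R.
have psi0 x t : (0 <= psi x t)%R by rewrite mulr_ge0.
have mpsi : measurable_fun (setT : set (mR * mR)) (fun z => (psi z.1 z.2)%:E).
  apply/measurable_EFinP; apply: measurable_funM.
    by apply: measurableT_comp.
  apply: (measurableT_comp (f := fun z : mR * mR => phi z.1 z.2)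
    (g := fun z : mR * mR => (z.1, (z.1 * z.2)%R))) => //.
  by apply: measurable_fun_pair => //; exact: measurable_funM.
have phi_npos x y : (x <= 0)%R -> phi x y = 0%R.
  by move=> x0; rewrite /phi /p gamma_pdf_npos// mul0r mulr0.
transitivity (\int[mu]_x \int[mu]_t (psi x t)%:E).
  apply: eq_integral => x _.
  have [x0|x0] := ltP 0%R x; last first.
    transitivity (0 : \bar R); last apply/esym; apply: integral0_eq => y _.
      by transitivity (phi x y)%:E => //; rewrite phi_npos.
    by rewrite /psi phi_npos ?mulr0.
  transitivity (\int[mu]_y (phi x y)%:E); first exact: eq_integral.
  have mphix : measurable_fun (setT : set mR) (fun y => (phi x y)%:E).
    apply/measurable_EFinP.
    apply: (measurableT_comp mphi (g := fun y => (x, y))).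
    exact: measurable_fun_pair.
  rewrite (ge0_integral_scale x0 mphix); last by move=> y; rewrite lee_fin.
  rewrite -ge0_integralZl//.
  - by apply: eq_integral => t _; rewrite /psi -EFinM gtr0_norm.
  - apply/measurable_EFinP.
    apply: (measurableT_comp (f := fun y => phi x y) (g := fun t => (x * t)%R)).
      exact/measurable_EFinP.
    exact: measurable_funM.
  - by move=> y _; rewrite lee_fin.
  - by rewrite lee_fin ltW.
rewrite (fubini_tonelli (fun z => (psi z.1 z.2)%:E) mpsi); last first.
  by move=> z; rewrite lee_fin.
rewrite [RHS]integral_mkcond; apply: eq_integral => t _; rewrite patchE.
case: ifPn => [|]; last first.
  rewrite notin_setE/= in_itv/= andbT => /negP; rewrite -leNgt => t0.
  apply: integral0_eq => x _; have [x0|x0] := ltP 0%R x; last first.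
    by rewrite /psi phi_npos ?mulr0.
  by rewrite /psi /phi /p (gamma_pdf_npos r (x := x * t)) ?mulr0// pmulr_rle0.
rewrite inE/= in_itv/= andbT => t0.
have t1 : (0 < (1 + t)^-1)%R by rewrite invr_gt0 addr_gt0.
have mpsit : measurable_fun (setT : set mR) (fun x => (psi x t)%:E).
  apply: (measurableT_comp mpsi (g := fun x => (x, t))).
  exact: measurable_fun_pair.
rewrite (ge0_integral_scale t1 mpsit); last by move=> x; rewrite lee_fin.
rewrite -ge0_integralZl//; last first.
- by rewrite lee_fin ltW.
- by move=> x _; rewrite lee_fin.
- apply: (measurableT_comp mpsit (g := fun x => ((1 + t)^-1 * x)%R)).
  exact: measurable_funM.
rewrite [RHS]integral_mkcond; apply: eq_integral => y _; rewrite patchE mulrC.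
case: ifPn => [|]; last first.
  rewrite notin_setE/= in_itv/= andbT => /negP; rewrite -leNgt => y0.
  by rewrite /psi phi_npos ?mulr0 ?mule0// pmulr_lle0.
rewrite inE/= in_itv/= andbT => y0; rewrite -EFinM; congr EFin.
have yt0 : (0 < y / (1 + t))%R by rewrite mulr_gt0.
rewrite /psi /phi /p !gamma_pdf_pos ?mulr_gt0// gtr0_norm//.
rewrite -gamma_kernel_ratio//.
by rewrite -!mulrA; ring.
Qed.

End Polar.

(** * Distribution function of a combination of two gamma variables *)

Section Cdf.
Context {R : realType} d (T : measurableType d) (P : probability T R).
Implicit Types (t x y th : R) (X Y : {RV P >-> R}).
Notation mu := (@lebesgue_measure R).
Notation mR := (measurableTypeR R).
Notation posline := (`]0%R, +oo[%classic : set R).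
Variable r : R.
Let c : R := (gamma_fun r)^-1 ^+ 2.

Definition gamma_pair X Y :=
  [/\ gamma_distributed X r 1, gamma_distributed Y r 1 & independent_RV2 X Y].

Lemma gamma_pairC X Y : gamma_pair X Y -> gamma_pair Y X.
Proof.
move=> [gX gY ind]; split => // A B mA mB.
by rewrite setIC muleC; exact: ind.
Qed.

Lemma probability_gamma_pair X Y (A : set (mR * mR)) : gamma_pair X Y -> measurable A ->
  P [set w | A (X w, Y w)] =
  (\int[mu]_(t in posline) \int[mu]_(y in posline)
    (\1_A ((y / (1 + t))%R, (y / (1 + t) * t)%R) *
      (c * (ratio_weight r t * gamma_kernel (2 * r) y)))%:E)%E.
Proof.
move=> [gX gY ind] mA; rewrite -integral_ratio_sum//.
have mg : measurable_fun (setT : set mR) (fun x => (gamma_pdf r 1 x)%:E).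
  by apply/measurable_EFinP; exact: measurable_gamma_pdf.
have g0 x : (0 <= (gamma_pdf r 1 x)%:E)%E by rewrite lee_fin gamma_pdf_ge0.
have mX : measurable_fun setT (X : T -> mR) by exact: (measurable_funP X).
have mY : measurable_fun setT (Y : T -> mR) by exact: (measurable_funP Y).
exact: (joint_density mX mY mg g0 mg g0 gX gY ind mA).
Qed.

Lemma measurable_gamma_kernel k : measurable_fun posline (gamma_kernel k).
Proof.
apply: measurable_fun_posline => y y0.
exact: has_deriv_continuous (has_deriv_gamma_kernel k y0).
Qed.

Lemma measurable_ratio_weight : measurable_fun posline (ratio_weight r).
Proof.
apply: measurable_fun_posline => y y0.
exact: has_deriv_continuous (has_deriv_ratio_weight r y0).
Qed.

(** The case of the sure event. It expresses the normalising constants through each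
other, so that neither Gamma nor Beta integrals have to be computed. *)
Lemma gamma_pair_total X Y : gamma_pair X Y ->
  (1 = c%:E * (\int[mu]_(t in posline) (ratio_weight r t)%:E *
               \int[mu]_(y in posline) (gamma_kernel (2 * r) y)%:E))%E.
Proof.
move=> gXY; rewrite -(probability_setT P).
rewrite -[setT]/[set w | setT (X w, Y w)] (probability_gamma_pair gXY)//.
have mw := measurable_ratio_weight.
have mk := measurable_gamma_kernel (2 * r).
have w0 t : (0 <= (ratio_weight r t)%:E)%E by rewrite lee_fin ltW ?ratio_weight_gt0.
have k0 y : (0 <= (gamma_kernel (2 * r) y)%:E)%E by rewrite lee_fin ltW ?gamma_kernel_gt0.
have mB : measurable (posline : set mR) := measurable_itv _.
have c0 : 0 <= c by rewrite exprn_ge0// invr_ge0 gamma_fun_ge0.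
transitivity (\int[mu]_(t in posline) ((c * ratio_weight r t)%:E *
    \int[mu]_(y in posline) (gamma_kernel (2 * r) y)%:E))%E.
  apply: eq_integral => t _; rewrite -ge0_integralZl//.
  - by apply: eq_integral => y _; rewrite indicT mul1r mulrA EFinM.
  - exact/measurable_EFinP.
  - by rewrite lee_fin mulr_ge0// ltW ?ratio_weight_gt0.
rewrite ge0_integralZr//.
- rewrite muleA; congr (_ * _)%E.
  by rewrite -[RHS]ge0_integralZl//; exact/measurable_EFinP.
- by apply/measurable_EFinP; apply: measurable_funM.
- by move=> t _; rewrite lee_fin mulr_ge0// ltW ?ratio_weight_gt0.
- by apply: integral_ge0.
Qed.

(** A product of two integrals that equals 1 after multiplication by a constant has
finite factors. *)
Lemma gamma_pair_integrable X Y : gamma_pair X Y ->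
  [/\ mu.-integrable posline (EFin \o ratio_weight r),
      mu.-integrable posline (EFin \o gamma_kernel (2 * r)) &
      1 = c * ((\int[mu]_(t in posline) ratio_weight r t) *
               (\int[mu]_(y in posline) gamma_kernel (2 * r) y))].
Proof.
move=> /gamma_pair_total.
set I := integral _ _ _; set J := integral _ _ _ => IJ.
have I0 : (0 <= I)%E by apply: integral_ge0 => t _; rewrite lee_fin ltW ?ratio_weight_gt0.
have J0 : (0 <= J)%E by apply: integral_ge0 => t _; rewrite lee_fin ltW ?gamma_kernel_gt0.
have c0 : 0 <= c by rewrite exprn_ge0// invr_ge0 gamma_fun_ge0.
have fin_of (a b : \bar R) : (0 <= a -> 0 <= b -> 1 = c%:E * (a * b) -> a \is a fin_num)%E.
  move=> a0 b0 e; rewrite ge0_fin_numE// ltey; apply/eqP => aoo; move: e.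
  have [->|bn0] := eqVneq b 0%E; first by rewrite !mule0 => -[/eqP]; rewrite oner_eq0.
  have b1 : (0 < b)%E by rewrite lt_neqAle eq_sym bn0.
  rewrite aoo gt0_mulye//.
  have [->|cn0] := eqVneq c 0; first by rewrite mul0e => -[/eqP]; rewrite oner_eq0.
  by rewrite gt0_muley// lte_fin lt_neqAle eq_sym cn0.
have If := fin_of _ _ I0 J0 IJ.
have Jf : J \is a fin_num by apply: (fin_of _ _ J0 I0); rewrite (muleC J).
split.
- apply/integrableP; split; first by apply/measurable_EFinP; exact: measurable_ratio_weight.
  rewrite (_ : integral _ _ _ = I) ?ltey_eq ?If//.
  by apply: eq_integral => t _ /=; rewrite gtr0_norm ?ratio_weight_gt0.
- apply/integrableP; split; first by apply/measurable_EFinP; exact: measurable_gamma_kernel.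
  rewrite (_ : integral _ _ _ = J) ?ltey_eq ?Jf//.
  by apply: eq_integral => t _ /=; rewrite gtr0_norm ?gamma_kernel_gt0.
- by move: IJ; rewrite -(fineK If) -(fineK Jf) => -[].
Qed.

Lemma skew_halfplane_measurable th x :
  measurable [set z : mR * mR | (1 - th) * z.1 + (1 + th) * z.2 <= x].
Proof.
pose f (z : mR * mR) : mR := (1 - th) * z.1 + (1 + th) * z.2.
have mf : measurable_fun setT f.
  by apply: measurable_funD; apply: measurable_funM.
rewrite (_ : [set z | _] = setT `&` f @^-1` `]-oo, x]).
  by apply: mf => //; exact: measurable_itv.
by rewrite setTI; apply/seteqP; split => z /=; rewrite in_itv.
Qed.

Lemma skew_halfplane_ray th x t y : -1 < th -> th < 1 -> 0 < t ->
  ((1 - th) * (y / (1 + t)) + (1 + th) * (y / (1 + t) * t) <= x) = (y <= x * rho th t).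
Proof.
move=> t1 t2 t0; have d0 := skew_den_gt0 t1 t2 t0.
have t01 : 0 < 1 + t by lra.
rewrite /rho [x * _]mulrA ler_pdivlMr// -(ler_pM2r t01); congr (_ <= _).
by field; rewrite gt_eqF.
Qed.

Lemma probability_skew_npos X Y th x : gamma_pair X Y -> -1 < th -> th < 1 ->
  x <= 0 -> P [set w | (1 - th) * X w + (1 + th) * Y w <= x] = 0%E.
Proof.
move=> gXY t1 t2 x0.
rewrite (probability_gamma_pair gXY (skew_halfplane_measurable th x)).
apply: integral0_eq => t; rewrite /= in_itv/= andbT => t0.
apply: integral0_eq => y; rewrite /= in_itv/= andbT => y0.
rewrite indicE memNset ?mul0r//= skew_halfplane_ray//; apply/negP.
by rewrite -ltNge (le_lt_trans _ y0)// mulr_le0_ge0// ltW// rho_gt0.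
Qed.

Lemma probability_skew X Y th x : gamma_pair X Y -> -1 < th -> th < 1 -> 0 < x ->
  P [set w | (1 - th) * X w + (1 + th) * Y w <= x] = (c * skew_cdf r th x)%:E.
Proof.
move=> gXY t1 t2 x0; have [iw ik _] := gamma_pair_integrable gXY.
rewrite (probability_gamma_pair gXY (skew_halfplane_measurable th x)).
set A := [set z : mR * mR | (1 - th) * z.1 + (1 + th) * z.2 <= x].
have mB : measurable (posline : set mR) := measurable_itv _.
have c0 : 0 <= c by rewrite exprn_ge0// invr_ge0 gamma_fun_ge0.
have iS := integrable_skew_integrand iw ik x0 t1 t2.
rewrite /skew_cdf -RintegralZl// /Rintegral fineK; last first.
  apply: integrable_fin_num => //.
  by have := integrableZl mB c iS.
apply: eq_integral => t; rewrite inE/= in_itv/= andbT => t0.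
have y0 : 0 < x * rho th t by rewrite mulr_gt0 ?rho_gt0.
transitivity ((c * ratio_weight r t)%:E *
    \int[mu]_(y in `]0%R, (x * rho th t)%R]) (gamma_kernel (2 * r) y)%:E)%E; last first.
  rewrite /lower_gamma /Rintegral mulrA [RHS]EFinM fineK//.
  apply: integrable_fin_num => //.
  have mI : measurable (`]0%R, x * rho th t]%classic : set mR) := measurable_itv _.
  apply: (integrableS mB mI _ ik).
  by move=> y; rewrite /= !in_itv/= andbT => /andP[].
rewrite -ge0_integralZl//; last first.
- by rewrite lee_fin mulr_ge0// ltW ?ratio_weight_gt0.
- by move=> y _; rewrite lee_fin ltW ?gamma_kernel_gt0.
- apply: measurable_funS (_ : measurable_fun posline _) => //.
    by move=> y; rewrite /= !in_itv/= andbT => /andP[].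
  by apply/measurable_EFinP; exact: measurable_gamma_kernel.
rewrite [LHS]integral_mkcond [RHS]integral_mkcond.
apply: eq_integral => y _; rewrite !patchE indicE.
have [yp|yn] := ltP 0 y; last first.
  by rewrite !memNset//= in_itv/= (le_gtF yn).
rewrite mem_set ?[posline y]/= ?in_itv/= ?yp//.
have -> : ((y / (1 + t), y / (1 + t) * t) \in A) = (y <= x * rho th t).
  rewrite -(skew_halfplane_ray x y t1 t2 t0).
  by apply/idP/idP => [|h]; [rewrite inE|rewrite inE].
have -> : (y \in `]0, x * rho th t]%classic) = (y <= x * rho th t).
  by apply/idP/idP; rewrite inE/= in_itv/= yp.
case: ifPn => _; last by rewrite mul0r.
by rewrite mul1r mulrA EFinM.
Qed.
End Cdf.

(** * Medians *)

Section Median.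
Context {R : realType} d (T : measurableType d) (P : probability T R).
Implicit Types (t x y th : R) (X Y Z : {RV P >-> R}).
Notation mu := (@lebesgue_measure R).

(** The infimum that defines the median is attained, by right-continuity. *)
Lemma half_le_cdf_median Z : has_inf [set x | ((2^-1)%:E <= cdf Z x)%E] ->
  ((2^-1)%:E <= cdf Z (median Z))%E.
Proof.
move=> infZ; have rc : cdf Z x @[x --> (median Z)^'+] --> cdf Z (median Z).
  exact: cdf_right_continuous.
apply: cvge_ge rc; near=> x.
have mx : median Z < x by near: x; exact: nbhs_right_gt.
have [y /= hy yx] := inf_lt (proj1 infZ) mx.
by rewrite (le_trans hy)// cdf_nondecreasing// ltW.
Unshelve. all: end_near. Qed.

Variables (r : R) (X1 X2 : {RV P >-> R}).
Hypotheses (r0 : 0 < r) (gX : gamma_pair r X1 X2).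
Let Z (a : R) : {RV P >-> R} := a *: X1 + (2 - a) *: X2.
Let c : R := (gamma_fun r)^-1 ^+ 2.
Let F (a x : R) : R := c * skew_cdf r (1 - a) x.

Lemma cdf_combination a x :
  cdf (Z a) x = P [set w | (1 - (1 - a)) * X1 w + (1 + (1 - a)) * X2 w <= x].
Proof.
have Zw w : (Z a w <= x) = ((1 - (1 - a)) * X1 w + (1 + (1 - a)) * X2 w <= x).
  have -> : 1 - (1 - a) = a by ring.
  have -> : 1 + (1 - a) = 2 - a by ring.
  by [].
rewrite (_ : [set w | _] = Z a @^-1` `]-oo, x])//.
by apply/seteqP; split => w; rewrite /= in_itv/= Zw.
Qed.

Lemma cdf_combination_npos a x : 0 < a -> a < 2 -> x <= 0 -> cdf (Z a) x = 0%E.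
Proof. by move=> a0 a2 x0; rewrite cdf_combination (probability_skew_npos gX)//; lra. Qed.

Lemma cdf_combination_pos a x : 0 < a -> a < 2 -> 0 < x -> cdf (Z a) x = (F a x)%:E.
Proof. by move=> a0 a2 x0; rewrite cdf_combination (probability_skew gX)//; lra. Qed.

(** Exchangeability: the closed form of the distribution function is the same for
[(X1, X2)] and for [(X2, X1)]. *)
Lemma cdf_combinationC a x : 0 < a -> a < 2 -> cdf (Z (2 - a)) x = cdf (Z a) x.
Proof.
move=> a0 a2; have [x0|x0] := leP x 0.
  by rewrite !cdf_combination_npos//; lra.
rewrite (cdf_combination_pos a0 a2 x0) -(probability_skew (gamma_pairC gX) _ _ x0); [|lra|lra].
rewrite cdf_combination.
have -> : 1 - (1 - (2 - a)) = 1 + (1 - a) by ring.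
have -> : 1 + (1 - (2 - a)) = 1 - (1 - a) by ring.
by under eq_set do rewrite addrC.
Qed.

Lemma median_combinationC a : 0 < a -> a < 2 -> median (Z a) = median (Z (2 - a)).
Proof.
move=> a0 a2; have cdfE : cdf (Z (2 - a)) = cdf (Z a).
  by apply/funext => x; exact: cdf_combinationC.
by rewrite /median cdfE.
Qed.

Lemma half_le_cdf_pos a x : 0 < a -> a < 2 -> ((2^-1)%:E <= cdf (Z a) x)%E -> 0 < x.
Proof.
move=> a0 a2; have [x0|//] := leP x 0.
by rewrite cdf_combination_npos// lee_fin; lra.
Qed.

Lemma scale_gt0 : 0 < c.
Proof.
have [iw ik e] := gamma_pair_integrable gX.
have c0 : 0 <= c by rewrite exprn_ge0// invr_ge0 gamma_fun_ge0.
rewrite lt_neqAle c0 andbT eq_sym; apply/eqP => c00.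
by move: e; rewrite -/c c00 mul0r => /eqP; rewrite oner_eq0.
Qed.

(** The mean [2 * r] lies strictly beyond the median: this holds in the wide sense
for the gamma law, which is the case [a = 1], and the distribution function at
[2 * r] increases strictly when [a] leaves 1. *)
Lemma half_lt_cdf_mean a : 0 < a -> a < 1 -> 2^-1 < F a (2 * r).
Proof.
move=> a0 a1; have [iw ik e] := gamma_pair_integrable gX.
have r20 : 0 < 2 * r by rewrite mulr_gt0.
have [d1 d2] : 0 < 1 - a /\ 1 - a < 1 by split; lra.
have lt0 := skew_cdf_lt r0 iw ik r20 (lexx _) (lexx 0) d1 d2.
apply: (@le_lt_trans _ _ (c * skew_cdf r 0 (2 * r))); last first.
  by rewrite /F ltr_pM2l ?scale_gt0.
rewrite skew_cdf0// -(ler_pM2l (_ : 0 < 2 :> R))// divff// [leLHS]e.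
have := gamma_median_le_mean r20 ik.
set M := Rintegral _ _ _; set W := Rintegral _ _ _ => MH.
have W0 : 0 <= W by apply: Rintegral_ge0 => t _; rewrite ltW ?ratio_weight_gt0.
have : c * (W * M) <= c * (W * (2 * lower_gamma (2 * r) (2 * r))).
  by rewrite ler_pM2l ?scale_gt0// ler_wpM2l.
by move=> /le_trans; apply; rewrite le_eqVlt; apply/orP; left; apply/eqP; ring.
Qed.

Lemma has_inf_half a : 0 < a -> a < 1 ->
  has_inf [set x | ((2^-1)%:E <= cdf (Z a) x)%E].
Proof.
move=> a0 a1; have a2 : a < 2 by lra.
split; last by exists 0 => x /= /(half_le_cdf_pos a0 a2)/ltW.
exists (2 * r) => /=; rewrite cdf_combination_pos ?mulr_gt0// lee_fin ltW//.
exact: half_lt_cdf_mean.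
Qed.

(** At the median [m] for [b], which is at most [2 * r], the distribution function
for [a] is larger than 1/2, and by continuity still is just before [m]. *)
Lemma median_combination_lt a b : 0 < a -> a < b -> b < 1 ->
  median (Z a) < median (Z b).
Proof.
move=> a0 ab b1; have [iw ik _] := gamma_pair_integrable gX.
have b0 : 0 < b by lra.
have a1 : a < 1 by lra.
have [a2 b2] : a < 2 /\ b < 2 by split; lra.
have [t1 t2] : -1 < 1 - a /\ 1 - a < 1 by split; lra.
have [t3 t4] : 0 <= 1 - b /\ 1 - b < 1 - a by split; lra.
have hb := half_le_cdf_median (has_inf_half b0 b1).
set m := median (Z b) in hb *.
have m0 : 0 < m := half_le_cdf_pos b0 b2 hb.
have m2r : m <= 2 * r.
  apply: inf_lbound; first by case: (has_inf_half b0 b1).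
  rewrite /= cdf_combination_pos ?mulr_gt0// lee_fin ltW//; exact: half_lt_cdf_mean.
move: hb; rewrite cdf_combination_pos// lee_fin => hb.
have Fm : 2^-1 < F a m.
  apply: (le_lt_trans hb); rewrite /F ltr_pM2l ?scale_gt0//.
  exact: skew_cdf_lt.
have cF : F a y @[y --> m] --> F a m.
  apply: cvgM; first exact: cvg_cst.
  exact: (continuous_skew_cdf iw ik m0 t1 t2).
have [y [y0 ym Fy]] : exists y, [/\ 0 < y, y < m & 2^-1 < F a y].
  have : \forall y \near m^'-, [/\ 0 < y, y < m & 2^-1 < F a y].
    near=> y; split.
    - by near: y; exact: nbhs_left_gt.
    - by near: y; exact: nbhs_left_lt.
    - near: y; apply: (cvgr_gt (F a m)) => //; exact: cvg_at_left_filter.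
  by move=> /filter_ex[y ?]; exists y.
have Sy : ((2^-1)%:E <= cdf (Z a) y)%E.
  by rewrite (cdf_combination_pos a0 a2 y0) lee_fin ltW.
have [_ lbS] := has_inf_half a0 a1.
exact: le_lt_trans (inf_lbound lbS Sy) ym.
Unshelve. all: end_near. Qed.
End Median.

Unset Implicit Arguments.

Theorem theorem2p1 (R : realType) (d : measure_display) (T : measurableType d)
    (P : probability T R) (r : R) (X1 X2 : {RV P >-> R}) :
  0 < r ->
  gamma_distributed X1 r 1 -> gamma_distributed X2 r 1 ->
  independent_RV2 X1 X2 ->
  let Z (alpha : R) : {RV P >-> R} := alpha *: X1 + (2 - alpha) *: X2 in
  (forall a b : R, 0 < a -> a < b -> b < 1 -> median (Z a) < median (Z b)) /\
  (forall a b : R, 1 < a -> a < b -> b < 2 -> median (Z b) < median (Z a)) /\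
  (forall a : R, 0 < a -> a < 2 -> median (Z a) = median (Z (2 - a))).
Proof.
move=> r0 gX1 gX2 ind Z.
have gX : gamma_pair r X1 X2 by [].
split; [|split].
- by move=> a b a0 ab b1; exact: (median_combination_lt r0 gX).
- move=> a b a1 ab b2.
  have a0 : 0 < a by lra.
  have b0 : 0 < b by lra.
  have a2 : a < 2 by lra.
  have [b0' ba a1'] : [/\ 0 < 2 - b, 2 - b < 2 - a & 2 - a < 1] by split; lra.
  have Ca := median_combinationC gX a0 a2.
  have Cb := median_combinationC gX b0 b2.
  have := median_combination_lt r0 gX b0' ba a1'.
  by rewrite -Ca -Cb.
- by move=> a a0 a2; exact: (median_combinationC gX).
Qed.
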